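(* Let $p$ be an odd prime, $\zeta=e^{2\pi i/p}$, and let $m,t\ge1$ be integers with $t(p-1)<2m$. Identify $\mathbb R^{2m}$ with $\mathbb C^m$ and let $\mathbb S^{2m-1}=\{\mathbf x\in\mathbb C^m:\|\mathbf x\|=1\}$. If $U_1,\dots,U_{t+1}$ are closed subsets covering $\mathbb S^{2m-1}$, then some $U_i$ contains a full orbit $\{\mathbf x,\zeta\mathbf x,\dots,\zeta^{p-1}\mathbf x\}$ for some $\mathbf x\in\mathbb S^{2m-1}$.
   Context: $\zeta\mathbf x$ denotes multiplication of every complex coordinate of $\mathbf x$ by $\zeta$; this is a free $\mathbb Z_p$-action on $\mathbb S^{2m-1}$. *)

(* Defs.v *)
From HB Require Import structures.
From mathcomp Require Import all_boot all_order all_algebra.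
From mathcomp Require Import all_classical all_reals all_analysis.
Set Implicit Arguments. Unset Strict Implicit. Unset Printing Implicit Defensive.
Import Order.TTheory GRing.Theory Num.Theory.
Import numFieldNormedType.Exports.
Local Open Scope ring_scope.
Local Open Scope classical_set_scope.

(* A point of C^m = R^(2m) is a pair (a, b) of real row vectors:
   the k-th complex coordinate is a_k + i b_k. *)
Notation cvec R m := ('rV[R]_m * 'rV[R]_m)%type.

Definition sphere (R : realType) (m : nat) : set (cvec R m) :=
  [set x : cvec R m | \sum_(j < m) (x.1 0 j ^+ 2 + x.2 0 j ^+ 2) = 1].

(* Multiplication of every complex coordinate by e^{i theta}. *)
Definition crot (R : realType) (m : nat) (theta : R) (x : cvec R m) : cvec R m :=
  (cos theta *: x.1 - sin theta *: x.2, sin theta *: x.1 + cos theta *: x.2).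

Definition zeta_pow (R : realType) (m p k : nat) (x : cvec R m) : cvec R m :=
  crot (2 * pi * k%:R / p%:R) x.

(* Main.v *)
Require Import Defs.
From HB Require Import structures.
From mathcomp Require Import all_boot all_order all_algebra.
From mathcomp Require Import all_classical all_reals all_analysis.
From mathcomp Require Import ring lra zify.
Set Implicit Arguments. Unset Strict Implicit. Unset Printing Implicit Defensive.
Import Order.TTheory GRing.Theory Num.Theory.
Import numFieldNormedType.Exports.
Local Open Scope ring_scope.

(* Suppose no U_i contains a full orbit.  By the covering property every orbit of the sphere
   meets one of the first t sets, so each nonzero x can be labelled equivariantly by a pair
   (i, k) with zeta^(-k) x/|x| in U_i, i < t; by compactness the labels on a sufficiently small
   set of points never exhaust {i} x F_p.  The join of 2m copies of F_p maps equivariantly and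
   affinely to C^m \ 0 (copies 2q and 2q+1 both go to the p-th roots of unity on the q-th axis:
   p being odd, no two of these are opposite), and it carries chains h_0, ..., h_(2m-1)
   satisfying d h_(k+1) = T_(k+1) h_k, where T alternates between g - 1 and the norm of F_p.
   On the label side there are alternating F_p-cochains c_0 = 1, c_(k+1) = delta b_k with
   T_(k+1) b_k = c_k, because F_p acts freely on the sets of labels above.  Evaluating c_k on the
   labels of a fine barycentric subdivision of h_k gives 1 for every k; but c_(2m-1) vanishes on
   them, since 2m > t(p-1) admissible labels always contain a repetition. *)

(** * Cochains on finite sequences *)

Section Cochains.
Variable V : comNzRingType.
Implicit Type T : Type.

Definition cone T (x : T) (f : seq T -> V) : seq T -> V := fun s => f (x :: s).

(** The augmented simplicial coboundary: the alternating sum of [f] over the deletions of one entry.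
    The recursion makes the dual of d (x * c) = c - x * d c hold by definition. *)
Fixpoint cobd T (f : seq T -> V) (s : seq T) : V :=
  if s is x :: s' then f s' - cobd (cone x f) s' else 0.

Lemma cone_cobd T (x : T) (f : seq T -> V) s :
  cone x (cobd f) s = f s - cobd (cone x f) s.
Proof. by []. Qed.

Lemma eq_cobd (T : eqType) (f g : seq T -> V) s :
  (forall u, subseq u s -> (size u).+1 = size s -> f u = g u) ->
  cobd f s = cobd g s.
Proof.
elim: s f g => //= x s IHs f g fg; congr (_ - _).
  by apply: fg => //; apply: subseq_cons.
apply: IHs => u su szu; apply: fg; last by rewrite /= szu.
by rewrite /= eqxx.
Qed.

Lemma cobd0 T s : cobd (fun _ : seq T => 0) s = 0.
Proof. by elim: s => //= x s IHs; rewrite /cone IHs subr0. Qed.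

Lemma cobdB T (f g : seq T -> V) s :
  cobd (fun u => f u - g u) s = cobd f s - cobd g s.
Proof.
elim: s f g => [|x s IHs] f g /=; first by rewrite subr0.
by rewrite (IHs (cone x f)); ring.
Qed.

Lemma cobdN T (f : seq T -> V) s : cobd (fun u => - f u) s = - cobd f s.
Proof.
by elim: s f => [|x s IHs] f /=; rewrite ?oppr0 // (IHs (cone x f)) opprB opprK addrC.
Qed.

Lemma cobd_sum T (I : finType) (f : I -> seq T -> V) s :
  cobd (fun u => \sum_i f i u) s = \sum_i cobd (f i) s.
Proof.
elim: s f => [|x s IHs] f /=; first by rewrite big1.
by rewrite sumrB -(IHs (fun i => cone x (f i))).
Qed.

Lemma cobd_cobd T (f : seq T -> V) s : cobd (cobd f) s = 0.
Proof.
elim: s f => //= x s IHs f.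
by rewrite (cobdB f (cobd (cone x f))) IHs subr0 subrr.
Qed.

Lemma cobd_map T T' (h : T -> T') (f : seq T' -> V) s :
  cobd f (map h s) = cobd (fun u => f (map h u)) s.
Proof. by elim: s f => //= x s IHs f; rewrite IHs. Qed.

Definition alt_cochain T (f : seq T -> V) :=
  forall s1 a b s2, f (s1 ++ a :: b :: s2) = - f (s1 ++ b :: a :: s2).

Lemma alt_cobd T (f : seq T -> V) : alt_cochain f -> alt_cochain (cobd f).
Proof.
move=> altf s1 a b s2; elim: s1 f altf => [|x s1 IHs] f altf /=.
  have -> : cone b (cone a f) = fun u => - cone a (cone b f) u.
    by apply: funext => u; rewrite /cone (altf [::]).
  rewrite cobdN; set c := cobd _ _; rewrite /cone; ring.
rewrite altf IHs ?opprB ?opprK 1?addrC //.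
by move=> u1 c d u2; apply: (altf (x :: u1)).
Qed.

End Cochains.

(** Adjacent swaps bring two equal entries together; swapping these gives f = -f, and 2 is
    invertible. *)
Lemma alt_dup (K : fieldType) (T : eqType) (f : seq T -> K) s :
  2%:R != 0 :> K -> alt_cochain f -> ~~ uniq s -> f s = 0.
Proof.
move=> K2 altf.
have dup s1 x s2 s0 : f (s0 ++ x :: s1 ++ x :: s2) = 0.
  elim: s1 s0 => [|y s1 IHs] s0 /=.
    have /eqP := altf s0 x x s2.
    by rewrite -addr_eq0 -mulr2n -mulr_natl mulf_eq0 (negPf K2) => /eqP.
  by rewrite altf -cat_rcons IHs oppr0.
suff {}dup' s0 : ~~ uniq s -> f (s0 ++ s) = 0 by move/(dup' [::]).
elim: s s0 => //= x s IHs s0; rewrite negb_and negbK => /orP[xs|/IHs h].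
  by case/splitPr: xs => s1 s2; apply: dup.
by rewrite -cat_rcons h.
Qed.

(** * The periodic resolution of the cyclic group *)

Section CyclicOperators.
Variables (p : nat) (T : Type) (act : 'F_p -> T -> T).
Hypothesis act_add : forall a b x, act (a + b) x = act a (act b x).
Implicit Type f : seq T -> 'F_p.

Definition odiff f s := f (map (act 1) s) - f s.
Definition osum f s := \sum_(a : 'F_p) f (map (act a) s).

(* The differentials of the periodic resolution of the trivial module over the cyclic group. *)
Definition period n := if odd n then odiff else osum.

Lemma map_act_add a b s : map (act a) (map (act b) s) = map (act (a + b)) s.
Proof. by rewrite -map_comp; apply: eq_map => x /=; rewrite act_add. Qed.

Lemma period_period n f s : period n.+1 (period n f) s = 0.
Proof.
rewrite /period /= /odiff /osum; case: (odd n) => /=.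
  rewrite sumrB; apply/eqP; rewrite subr_eq0; apply/eqP.
  rewrite [RHS](reindex_inj (addrI 1)) /=.
  by apply: eq_bigr => a _; rewrite map_act_add.
apply/eqP; rewrite subr_eq0; apply/eqP.
rewrite [RHS](reindex_inj (addIr 1)) /=.
by apply: eq_bigr => a _; rewrite map_act_add.
Qed.

Lemma periodSS n : period n.+2 = period n.
Proof. by rewrite /period /= negbK. Qed.

Lemma cobd_period n f s : cobd (period n f) s = period n (cobd f) s.
Proof.
rewrite /period; case: (odd n); rewrite /odiff /osum.
  by rewrite cobdB cobd_map.
by rewrite cobd_sum; apply: eq_bigr => a _; rewrite cobd_map.
Qed.

Lemma eq_period n f g s :
  (forall a, f (map (act a) s) = g (map (act a) s)) -> f s = g s ->
  period n f s = period n g s.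
Proof.
move=> fg fgs; rewrite /period; case: (odd n); first by rewrite /odiff fg fgs.
by apply: eq_bigr => a _.
Qed.

Lemma period_nil n (hp : prime p) f : period n f [::] = 0.
Proof.
rewrite /period; case: (odd n); first by rewrite /odiff subrr.
by rewrite /osum /= sumr_const card_Fp // -mulr_natl pchar_Fp_0 // mul0r.
Qed.

(* The tower of cones [v_n * (T_n (v_(n-1) * ...))] resolving the group inside the
   join of the orbits of [v]. *)
Fixpoint tower (v : nat -> T) n f : 'F_p :=
  if n is n'.+1 then tower v n' (period n (cone (v n) f)) else f [:: v 0].

Lemma towerB v n f g : tower v n (fun s => f s - g s) = tower v n f - tower v n g.
Proof.
elim: n f g => //= n IHn f g; rewrite -IHn; congr tower.
apply: funext => s; rewrite /period /odiff /osum /cone /=.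
case: (odd n) => /=; first by rewrite sumrB.
by ring.
Qed.

Lemma tower0 v n : tower v n (fun=> 0) = 0.
Proof.
rewrite -[RHS](subrr (tower v n (fun=> 0))) -towerB; congr tower.
by apply: funext => s; rewrite subrr.
Qed.

(** Dual of d h_(n+1) = T_(n+1) h_n. The boundary of a cone is its base minus the cone over the
    boundary of the base; by induction the latter involves two consecutive operators, whose product
    is 0. *)
Lemma tower_cobd (hp : prime p) v n f : tower v n.+1 (cobd f) = tower v n (period n.+1 f).
Proof.
elim: n f => [|n IHn] f.
  by rewrite /= /period /odiff /cone /= !subr0; ring.
have E : period n.+2 (cone (v n.+2) (cobd f)) =
   fun s => period n.+2 f s - cobd (period n.+2 (cone (v n.+2) f)) s.
  apply: funext => s; rewrite cobd_period.
  rewrite /period /odiff /osum; case: (odd _) => /=; last by rewrite -sumrB.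
  by rewrite !cone_cobd; ring.
rewrite -[LHS]/(tower v n.+1 (period n.+2 (cone (v n.+2) (cobd f)))) E.
rewrite (towerB v n.+1 (period n.+2 f)) IHn.
have -> : period n.+1 (period n.+2 (cone (v n.+2) f)) = fun=> 0.
  by apply: funext => s; rewrite -periodSS period_period.
by rewrite tower0 subr0.
Qed.

End CyclicOperators.

Section TowerSupport.
Variables (p : nat) (T : eqType) (act : 'F_p -> T -> T) (v : nat -> T).
Hypothesis act_add : forall a b x, act (a + b) x = act a (act b x).
Hypothesis act0 : forall x, act 0 x = x.
Implicit Type f : seq T -> 'F_p.

(** A single translate [a j] per level [j]: these are the simplices of the join of the orbits. *)
Definition tower_simplex n (s : seq T) :=
  size s = n.+1 /\ exists a : nat -> 'F_p,
    forall x, x \in s -> exists2 j, (j <= n)%N & x = act (a j) (v j).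

Lemma eq_tower n f g :
  (forall s, tower_simplex n s -> f s = g s) -> tower act v n f = tower act v n g.
Proof.
elim: n f g => [|n IHn] f g fg /=.
  apply: fg; split=> //; exists (fun=> 0) => x; rewrite inE => /eqP->.
  by exists 0%N; rewrite ?act0.
apply: IHn => s [ss [a sa]].
have simp b : tower_simplex n.+1 (v n.+1 :: map (act b) s).
  split; first by rewrite /= size_map ss.
  exists (fun j => if (j <= n)%N then b + a j else 0) => x.
  rewrite inE => /predU1P[->|/mapP[y /sa[j jn ->] ->]].
    by exists n.+1; rewrite ?ltnn ?act0.
  by exists j; rewrite ?jn ?act_add // leqW.
apply: eq_period => [b|]; first exact: fg.
have := simp 0; rewrite (_ : map _ s = s); first exact: fg.
by rewrite -[RHS]map_id; apply: eq_map.
Qed.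

End TowerSupport.

(** * Labels *)

Section Barycenter.
Variables (p : nat) (hp : prime p).
Implicit Types (S : {set 'F_p}) (a : 'F_p).

(** The mean of [S]: for nonempty proper [S] the cardinality is invertible modulo [p], so this is a
    translation-equivariant choice of a point of F_p. *)
Definition Fp_center S : 'F_p := (\sum_(k in S) k) / #|S|%:R.

Lemma Fp_center_shift S a : (0 < #|S| < p)%N ->
  Fp_center [set k | k - a \in S] = Fp_center S + a.
Proof.
move=> /andP[S0 Sp]; have -> : [set k | k - a \in S] = +%R^~ a @: S.
  apply/setP => k; rewrite inE; apply/idP/imsetP => [kS|[j jS ->]].
    by exists (k - a) => //; rewrite subrK.
  by rewrite addrK.
have injS : {in S &, injective (+%R^~ a)} by move=> j k _ _ /addIr.
have Sn0 : #|S|%:R != 0 :> 'F_p.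
  by rewrite -(dvdn_pcharf (pchar_Fp hp)) gtnNdvd.
rewrite /Fp_center card_imset; last exact: addIr.
rewrite big_imset //= big_split /= mulrDl sumr_const -[a *+ _]mulr_natr; congr (_ + _).
by rewrite mulfK.
Qed.

End Barycenter.

Section Labels.
Variables (p t : nat) (hp : prime p) (hodd : odd p).
Local Notation L := ('I_t * 'F_p)%type.
Implicit Types (s u : seq L) (f g : seq L -> 'F_p).

Definition shift_label (a : 'F_p) (l : L) : L := (l.1, l.2 + a).

Lemma shift_add a b l : shift_label (a + b) l = shift_label a (shift_label b l).
Proof. by rewrite /shift_label /= -addrA (addrC b). Qed.

Lemma mem_shift a s i k : ((i, k) \in map (shift_label a) s) = ((i, k - a) \in s).
Proof.
apply/mapP/idP => [[[j l] jl [-> ->]]|ks] /=; first by rewrite addrK.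
by exists (i, k - a) => //; rewrite /shift_label /= subrK.
Qed.

Definition fiber s i := [set k | (i, k) \in s].

(** A missing label in each copy of F_p is what makes the shift action free on nonempty label
    sets. *)
Definition proper_labels s := forall i, exists k, (i, k) \notin s.

Lemma proper_labels_sub s u : {subset u <= s} -> proper_labels s -> proper_labels u.
Proof. by move=> us ps i; have [k ks] := ps i; exists k; apply: contra ks => /us. Qed.

Lemma proper_labels_shift a s : proper_labels s -> proper_labels (map (shift_label a) s).
Proof.
by move=> ps i; have [k ks] := ps i; exists (k + a); rewrite mem_shift addrK.
Qed.

Lemma card_fiber_proper s i : proper_labels s -> (#|fiber s i| < p)%N.
Proof.
move=> /(_ i)[k ks]; rewrite -[X in (_ < X)%N](card_Fp hp) -cardsT.
apply: proper_card; rewrite properT; apply/eqP => /setP/(_ k).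
by rewrite !inE (negPf ks).
Qed.

(* Depends only on the underlying set of labels, so weights built from it keep cochains alternating. *)
Definition phase s : 'F_p :=
  if [pick i | fiber s i != finset.set0] is Some i then Fp_center (fiber s i) else 0.

Lemma eq_phase s u : s =i u -> phase s = phase u.
Proof.
move=> su; rewrite /phase; have E i : fiber s i = fiber u i.
  by apply/setP => k; rewrite !inE su.
by under eq_pick => i do rewrite E; case: pickP => // i _; rewrite E.
Qed.

(** A shift preserves which fibers are nonempty, so the same [i] is picked and its mean moves by
    [a]. The empty sequence is fixed by shifts and has to be excluded. *)
Lemma phase_shift a s : proper_labels s -> s != [::] ->
  phase (map (shift_label a) s) = phase s + a.
Proof.
move=> ps s0; rewrite /phase.
have E i : fiber (map (shift_label a) s) i = [set k | k - a \in fiber s i].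
  by apply/setP => k; rewrite !inE mem_shift.
have E0 i : (fiber (map (shift_label a) s) i != finset.set0) = (fiber s i != finset.set0).
  rewrite E; apply/set0Pn/set0Pn => [[k]|[k ks]]; rewrite ?inE => *.
    by exists (k - a); rewrite inE.
  by exists (k + a); rewrite inE addrK.
rewrite (eq_pick E0); case: pickP => [i i0|noi].
  by rewrite E Fp_center_shift // card_gt0 i0 card_fiber_proper.
case: s s0 noi {ps E E0} => // -[i k] s _ /(_ i) /negbFE/eqP/setP/(_ k).
by rewrite !inE eqxx.
Qed.

(** Common form of the two primitives below; for proper nonempty [s], [a] is the phase of the
    translate at which [f] is read. *)
Lemma alt_phase f (c : 'F_p -> 'F_p -> 'F_p) :
  alt_cochain f ->
  alt_cochain (fun s => \sum_(a : 'F_p) c (phase s) a * f (map (shift_label (a - phase s)) s)).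
Proof.
move=> altf s1 x y s2.
have -> : phase (s1 ++ x :: y :: s2) = phase (s1 ++ y :: x :: s2).
  by apply: eq_phase => l; rewrite !mem_cat !inE; congr (_ || _); rewrite orbCA.
rewrite -sumrN; apply: eq_bigr => a _.
by rewrite !map_cat /= altf mulrN.
Qed.

(** An invariant cochain is the norm of its restriction to phase 0, since each free orbit has
    exactly one member of that phase. *)
Lemma osum_solve f : alt_cochain f -> f [::] = 0 ->
  (forall s, proper_labels s -> odiff shift_label f s = 0) ->
  exists2 g, alt_cochain g & forall s, proper_labels s -> osum shift_label g s = f s.
Proof.
move=> altf f0 df.
have inv a s : proper_labels s -> f (map (shift_label a) s) = f s.
  move=> ps; rewrite -[a]natr_Zp; elim: (val a) => [|n IHn].
    congr f; rewrite -[RHS]map_id; apply: eq_map => -[i k].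
    by rewrite /shift_label /= addr0.
  rewrite -natr1 addrC -map_act_add; last exact: shift_add.
  rewrite -IHn; apply/eqP; rewrite -subr_eq0; apply/eqP.
  by apply: df; apply: proper_labels_shift.
exists (fun s => \sum_(a : 'F_p) (a == phase s)%:R * (phase s == 0)%:R
   * f (map (shift_label (a - phase s)) s)).
  exact: (alt_phase (fun b a => (a == b)%:R * (b == 0)%:R) altf).
move=> s ps; have [->|s0] := eqVneq s [::].
  by rewrite -[osum _ _ _]/(period shift_label 0 _ [::]) period_nil.
rewrite /osum (bigD1 (- phase s)) //= [X in _ + X]big1 ?addr0 => [|a ane].
  rewrite (bigD1 0) //= [X in _ + X]big1 => [|b bne]; rewrite phase_shift // subrr.
    by rewrite eqxx !mul1r !inv ?addr0 //; do ?apply: proper_labels_shift.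
  by rewrite (negPf bne) !mul0r.
apply: big1 => b _; rewrite phase_shift // (addrC (phase s)) addr_eq0 (negPf ane).
by rewrite mulr0 mul0r.
Qed.

(** The primitive sums [f] along the orbit of [s] from phase 0 up to, but excluding, the phase of
    [s]; the vanishing norm makes this consistent around the cycle. *)
Lemma odiff_solve f : alt_cochain f -> f [::] = 0 ->
  (forall s, proper_labels s -> osum shift_label f s = 0) ->
  exists2 g, alt_cochain g & forall s, proper_labels s -> odiff shift_label g s = f s.
Proof.
move=> altf f0 sf.
exists (fun s => \sum_(a : 'F_p) (a < phase s)%N%:R * f (map (shift_label (a - phase s)) s)).
  exact: (alt_phase (fun b a => (a < b)%N%:R) altf).
move=> s ps; have [->|s0] := eqVneq s [::]; first by rewrite f0 -[LHS]/(_ - _) subrr.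
rewrite /odiff phase_shift //; set b := phase s.
under eq_bigr => a _ do rewrite (map_act_add shift_add) opprD addrA subrK.
pose F (a : 'F_p) := f (map (shift_label (a - b)) s).
have sF : \sum_a F a = 0.
  rewrite -[RHS](sf s ps) /osum [RHS](reindex_inj (addIr (- b))) /=.
  by apply: eq_bigr.
have -> : f s = F b.
  rewrite /F subrr; congr f; rewrite -[LHS]map_id; apply: eq_map => -[i k].
  by rewrite /shift_label /= addr0.
rewrite -[X in X - _ = _]/(\sum_(a : 'F_p) (a < (b + 1)%R)%N%:R * F a).
rewrite -[X in _ - X = _]/(\sum_(a : 'F_p) (a < b)%N%:R * F a).
have pE : (Zp_trunc (pdiv p)).+2 = p by exact: Fp_cast.
have val1 : nat_of_ord (b + 1) = (b.+1 %% p)%N.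
  by rewrite /= modnDmr addn1 [X in (_ %% X)%N]pE.
have ltbp (a : 'F_p) : (a < p)%N by rewrite -[X in (_ < X)%N]pE.
have [bp|bp] := ltnP b.+1 p.
  rewrite -sumrB (bigD1 b) // big1 => [|a ab].
    by rewrite val1 modn_small // ltnSn ltnn mul1r mul0r subr0 -[RHS]addr0.
  rewrite val1 modn_small // ltnS leq_eqVlt.
  by rewrite -val_eqE /= in ab; rewrite (negPf ab) subrr.
(* At the last phase b + 1 wraps to 0: the new partial sum is empty and the old one is the full sum,
   which is 0, minus [F b]. *)
have bE : b.+1 = p by apply/eqP; rewrite eqn_leq bp ltbp.
rewrite val1 bE modnn big1 ?sub0r => [|a _]; last by rewrite mul0r.
apply/eqP; rewrite eq_sym -addr_eq0 -[X in _ == X]sF; apply/eqP.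
rewrite [RHS](bigD1 b) //; congr (_ + _).
rewrite [LHS](bigD1 b) // ltnn mul0r [LHS]add0r; apply: eq_bigr => a ab.
have := ltbp a; rewrite -[X in (_ < X)%N -> _]bE ltnS leq_eqVlt.
by rewrite -val_eqE /= in ab; rewrite (negPf ab) /= => ->; rewrite mul1r.
Qed.

Lemma period_solve n f : alt_cochain f -> f [::] = 0 ->
  (forall s, proper_labels s -> period shift_label n f s = 0) ->
  exists2 g, alt_cochain g & forall s, proper_labels s -> period shift_label n.+1 g s = f s.
Proof. by rewrite /period /=; case: (odd n); [apply: osum_solve | apply: odiff_solve]. Qed.

Lemma size_proper_labels s : proper_labels s -> uniq s -> (size s <= t * (p - 1))%N.
Proof.
move=> ps us; rewrite -(card_uniqP us).
have -> : #|s| = \sum_(i < t) #|fiber s i|.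
  rewrite -sum1_card (eq_bigr (fun i => \sum_k ((i, k) \in s : nat))); last first.
    by move=> i _; rewrite -sum1_card big_mkcond; apply: eq_bigr => k _; rewrite inE; case: ifP.
  rewrite pair_bigA /= big_mkcond; apply: eq_bigr => -[i k] _ /=.
  by case: (_ \in _).
rewrite -[X in (X * _)%N]card_ord -sum_nat_const; apply: leq_sum => i _.
by rewrite leq_subRL ?prime_gt0 // add1n card_fiber_proper.
Qed.

(* [J k] stands for evaluation on the image, under an equivariant labelling, of the
   [k]-chain of a periodic resolution. *)
Lemma labelled_tower_false N (J : nat -> (seq L -> 'F_p) -> 'F_p) :
  (t * (p - 1) < N)%N ->
  (forall k f g, (k < N)%N ->
    (forall s, proper_labels s -> size s = k.+1 -> f s = g s) -> J k f = J k g) ->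
  (forall k f, (k.+1 < N)%N -> J k.+1 (cobd f) = J k (period shift_label k.+1 f)) ->
  (forall k, J k (fun=> 0) = 0) -> J 0 (fun s => (size s == 1%N)%:R) = 1 -> False.
Proof.
move=> tN Jeq Jcobd J0 J1.
have F2 : 2%:R != 0 :> 'F_p.
  rewrite -(dvdn_pcharf (pchar_Fp hp)) gtnNdvd //.
  by move: (prime_gt1 hp) hodd; case: p => [|[|[|]]].
(* These are the cochains c_k. The cocycle condition is carried along because T_(k+1) c_(k+1) is the
   coboundary of c_k. *)
have H k : (k < N)%N -> exists f, [/\ alt_cochain f, f [::] = 0,
    forall s, proper_labels s -> period shift_label k f s = 0, forall s, cobd f s = 0 & J k f = 1].
  elim: k => [|k IHk] kN.
    (* The augmentation: its norm is [p] times itself, and on an edge its coboundary is 1 - 1. *)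
    exists (fun s => (size s == 1%N)%:R); split=> //.
    - move=> s1 a b s2; rewrite !size_cat /= !addnS /=.
      by rewrite oppr0.
    - move=> s _; rewrite -[LHS]/(\sum_a _) (eq_bigr (fun=> (size s == 1%N)%:R)).
        by rewrite sumr_const card_Fp // -[_ *+ p]mulr_natl pchar_Fp_0 // mul0r.
      by move=> a _; rewrite size_map.
    - move=> s; have [s2|s2] := eqVneq (size s) 2%N.
        by case: s s2 => [|x [|y []]] //= _; rewrite /cone /= !subr0 subrr.
      rewrite -[RHS](cobd0 _ s); apply: eq_cobd => u _ szu.
      by rewrite -eqSS szu (negPf s2).
  have [f [altf f0 Tf df Jf]] := IHk (ltnW kN).
  have [g altg Tg] := period_solve altf f0 Tf.
  exists (cobd g); split=> //.
  - exact: alt_cobd.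
  - move=> s ps; rewrite -cobd_period -(df s); apply: eq_cobd => u us _.
    by apply: Tg; apply: proper_labels_sub ps; apply: mem_subseq.
  - exact: cobd_cobd.
  - by rewrite Jcobd // -Jf; apply: Jeq => [|s ps _]; [apply: ltnW | apply: Tg].
have N0 : (N.-1 < N)%N by case: (N) tN.
have [f [altf _ _ _]] := H _ N0.
(* In degree N - 1 the sequences have [N] entries, too many for distinct proper labels, so the
   alternating [f] vanishes there although its evaluation is 1. *)
rewrite (Jeq _ _ (fun=> 0)) // ?J0 => [/esym/eqP|s ps szs]; first by rewrite oner_eq0.
apply: alt_dup => //; apply: contraTN tN => us.
by rewrite -leqNgt -(prednK (leq_ltn_trans (leq0n _) N0)) -szs size_proper_labels.
Qed.

End Labels.

Local Open Scope classical_set_scope.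

(** * Barycentric subdivision *)

Section Subdivision.
Variables (V : comNzRingType) (R : realType) (X : normedModType R).
Implicit Types (f g : seq X -> V) (s u : seq X) (x y : X).

Definition bary s : X := (size s)%:R^-1 *: \sum_(x <- s) x.

(** Dual of the recursion Sd s = b_s * Sd (d s); [n] is fuel, meant to be the size of [s]. *)
Fixpoint subdiv n f s : V :=
  if n is n'.+1 then cobd (subdiv n' (cone (bary s) f)) s else f [::].

(* The cochain operator dual to barycentric subdivision of affine simplices. *)
Definition sd f s := subdiv (size s) f s.

Lemma sdS f s : s != [::] -> sd f s = cobd (sd (cone (bary s) f)) s.
Proof.
move=> s0; have E : size s = (size s).-1.+1 by case: (s) s0.
rewrite [LHS]/sd E; apply: eq_cobd => u _ us.
by rewrite -us.
Qed.

Lemma sdB f g s : sd (fun u => f u - g u) s = sd f s - sd g s.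
Proof.
rewrite /sd; move: (size s) => n; elim: n f g s => //= n IHn f g u.
by rewrite -cobdB; congr cobd; apply: funext => w; rewrite -IHn.
Qed.

(** Expanding the coboundary under the cone leaves [cobd (sd f)] and an error term, which by
    induction on faces is a double coboundary. *)
Lemma sd_cobd f s : sd (cobd f) s = cobd (sd f) s.
Proof.
have [n] := ubnP (size s); elim: n => // n IHn in f s *; rewrite ltnS => sn.
have [->//|s0] := eqVneq s [::]; rewrite sdS //; set b := bary s.
have -> : sd (cone b (cobd f)) = fun u => sd f u - sd (cobd (cone b f)) u.
  by apply: funext => u; rewrite -sdB.
rewrite cobdB [X in _ - X](_ : _ = 0) ?subr0 //.
rewrite -(cobd_cobd (sd (cone b f)) s); apply: eq_cobd => u _ us.
by apply: IHn; rewrite us.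
Qed.

Lemma bary_map (h : {linear X -> X}) s : bary (map h s) = h (bary s).
Proof. by rewrite /bary size_map big_map linearZ (linear_sum h). Qed.

Lemma sd_map (h : {linear X -> X}) f s :
  sd f (map h s) = sd (fun u => f (map h u)) s.
Proof.
rewrite /sd size_map; move: (size s) => n; elim: n f s => //= n IHn f u.
rewrite cobd_map bary_map; congr cobd; apply: funext => w.
by rewrite IHn.
Qed.

(** A substitute for convexity, sufficient because subdivision vertices arise by iterated
    barycenters. *)
Definition avg_closed (C : X -> Prop) :=
  forall s, s != [::] -> (forall x, x \in s -> C x) -> C (bary s).

Definition small (d : R) s := forall x y, x \in s -> y \in s -> `|x - y| <= d.

(** The hull is encoded as the intersection of all averaging-closed sets containing [s], so that
    bounds pass to it by instantiating [C]. *)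
Definition in_hull s u :=
  forall C, avg_closed C -> (forall x, x \in s -> C x) -> forall x, x \in u -> C x.

Lemma subr_bary x s : s != [::] ->
  x - bary s = (size s)%:R^-1 *: \sum_(y <- s) (x - y).
Proof.
rewrite -size_eq0 => s0; rewrite sumrB scalerBr; congr (_ - _).
rewrite big_const_seq count_predT iter_addr_0 -[x *+ _]scaler_nat scalerA.
by rewrite mulVf ?scale1r // pnatr_eq0.
Qed.

Lemma avg_closed_ball x d : avg_closed (fun y => `|x - y| <= d).
Proof.
move=> s s0 sd; have n0 : 0 < (size s)%:R :> R by rewrite ltr0n lt0n size_eq0.
rewrite subr_bary // normrZ gtr0_norm ?invr_gt0 // mulrC ler_pdivrMr //.
apply: le_trans (ler_norm_sum _ _ _) _; rewrite big_seq.
apply: le_trans (ler_sum _ sd) _.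
by rewrite -big_seq big_const_seq count_predT iter_addr_0 mulr_natr.
Qed.

(** The difference x - x drops out of the average, leaving n - 1 terms out of n, and (n - 1) / n
    increases with n. *)
Lemma bary_small d s N x : (size s <= N)%N -> small d s -> x \in s ->
  `|bary s - x| <= (N.-1)%:R / N%:R * d.
Proof.
move=> sN ds xs.
have d0 : 0 <= d by apply: le_trans (ds x x xs xs).
have s0 : s != [::] by case: (s) xs.
have n0 : 0 < (size s)%:R :> R by rewrite ltr0n lt0n size_eq0.
rewrite distrC subr_bary // normrZ gtr0_norm ?invr_gt0 //.
have sE : `|\sum_(y <- s) (x - y)| <= (size s).-1%:R * d.
  rewrite (big_rem x xs) /= subrr add0r.
  apply: le_trans (ler_norm_sum _ _ _) _; rewrite big_seq.
  apply: (@le_trans _ _ (\sum_(y <- rem x s | y \in rem x s) d)).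
    by apply: ler_sum => y /mem_rem ys; apply: ds.
  by rewrite -big_seq big_const_seq count_predT iter_addr_0 size_rem // mulr_natl.
apply: le_trans (ler_wpM2l _ sE) _; first by rewrite invr_ge0 ltW.
rewrite mulrA; apply: ler_wpM2r => //.
rewrite mulrC ler_pdivrMr // mulrAC ler_pdivlMr; last first.
  by rewrite ltr0n (leq_trans _ sN) // lt0n size_eq0.
rewrite -!natrM ler_nat.
move: s0 sN; rewrite -size_eq0 -lt0n; case: (size s) => // a _; case: N => // b.
by rewrite ltnS /= !mulnS mulnC leq_add2r.
Qed.

Lemma in_hull_refl s : in_hull s s.
Proof. by move=> C. Qed.

Lemma in_hull_trans s u w : in_hull s u -> in_hull u w -> in_hull s w.
Proof. by move=> su uw C C1 C2; apply: uw => //; apply: su. Qed.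

Lemma in_hull_sub s u : {subset u <= s} -> in_hull s u.
Proof. by move=> us C _ Cs x /us/Cs. Qed.

(** Locates the simplices of one subdivision. A bound [N] in place of the size of [s] keeps the
    contraction factor the same for all faces. *)
Lemma eq_sd N d f g s : (size s <= N)%N -> small d s ->
  (forall u, size u = size s -> small ((N.-1)%:R / N%:R * d) u -> in_hull s u -> f u = g u) ->
  sd f s = sd g s.
Proof.
have [n] := ubnP (size s); elim: n => // n IHn in f g s *; rewrite ltnS => sn sN ds fg.
have [s_eq|s0] := eqVneq s [::].
  by rewrite s_eq; apply: fg; rewrite ?s_eq // => C.
rewrite !sdS //; apply: eq_cobd => u us szu.
have sub := mem_subseq us.
apply: IHn; [by rewrite szu | exact: leq_trans (size_subseq us) _ | | ].
  by move=> x y /sub xs /sub; apply: ds.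
move=> w wu dw uw; apply: fg; first by rewrite /= wu.
  (* Balls are averaging-closed, so the bound for the vertices of the face extends to its hull. *)
  have bw y : y \in w -> `|bary s - y| <= (N.-1)%:R / N%:R * d.
    apply: (uw _ (@avg_closed_ball (bary s) _)) => x /sub.
    exact: (bary_small sN ds).
  have e0 : 0 <= (N.-1)%:R / N%:R * d.
    case: (s) s0 ds => // z s' _ /(_ z z); rewrite mem_head => /(_ isT isT).
    by move=> /(le_trans (normr_ge0 _)) d0; rewrite !mulr_ge0 ?invr_ge0 ?ler0n.
  move=> x y; rewrite !inE => /predU1P[->|xw] /predU1P[->|yw]; last exact: dw.
  - by rewrite subrr normr0.
  - exact: bw.
  - by rewrite distrC; apply: bw.
move=> C Cavg Cs x; rewrite inE => /predU1P[->|xw]; first exact: Cavg.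
by apply: (in_hull_trans (in_hull_sub sub) uw).
Qed.

Lemma eq_iter_sd N r d f g s : (size s <= N)%N -> small d s ->
  (forall u, size u = size s -> small (((N.-1)%:R / N%:R) ^+ r * d) u -> in_hull s u ->
    f u = g u) ->
  iter r sd f s = iter r sd g s.
Proof.
elim: r d s => [|r IHr] d s sN ds fg; first by apply: fg; rewrite ?mul1r //; apply: in_hull_refl.
rewrite !iterS; apply: (eq_sd sN ds) => u us du su; apply: (IHr _ _ _ du).
  by rewrite us.
move=> w wu dw uw; apply: fg; rewrite ?wu //; last exact: in_hull_trans uw.
by rewrite exprSr -mulrA.
Qed.

Lemma iter_sd_cobd r f : iter r sd (cobd f) = cobd (iter r sd f).
Proof.
by elim: r => //= r ->; apply: funext => s; rewrite sd_cobd.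
Qed.

Lemma iter_sd_map (h : {linear X -> X}) r f s :
  iter r sd f (map h s) = iter r sd (fun u => f (map h u)) s.
Proof.
elim: r s => //= r IHr s; rewrite sd_map; congr sd.
by apply: funext => u; rewrite IHr.
Qed.

Lemma iter_sdB r f g :
  iter r sd (fun u => f u - g u) = fun s => iter r sd f s - iter r sd g s.
Proof. by elim: r => //= r ->; apply: funext => s; rewrite sdB. Qed.

Lemma iter_sd_sum r (I : finType) (F : I -> seq X -> V) s :
  iter r sd (fun u => \sum_i F i u) s = \sum_i iter r sd (F i) s.
Proof.
have sd_sum (G : I -> seq X -> V) w : sd (fun u => \sum_i G i u) w = \sum_i sd (G i) w.
  rewrite /sd; move: (size w) => n; elim: n G w => //= n IHn G w.
  rewrite -(cobd_sum (fun i => subdiv n (cone (bary w) (G i)))).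
  by congr cobd; apply: funext => u; rewrite -IHn.
elim: r s => //= r IHr s; rewrite -(sd_sum (fun i => iter r sd (F i))).
by congr sd; apply: funext => u.
Qed.

End Subdivision.

(** * Rotations of the complex space *)

Section Rotation.
Variables (R : realType) (m : nat).
Implicit Types (x y : cvec R m) (a b : R).

Lemma crot_is_linear a : linear (@crot R m a).
Proof.
move=> k x y; rewrite /crot; congr pair; apply/rowP => j; rewrite !mxE; ring.
Qed.

HB.instance Definition _ a :=
  GRing.isLinear.Build R (cvec R m) (cvec R m) *:%R (@crot R m a) (crot_is_linear a).

Lemma crotD a b x : crot (a + b) x = crot a (crot b x).
Proof.
rewrite /crot cosD sinD; congr pair; apply/rowP => j; rewrite !mxE; ring.
Qed.

Definition sqnorm x : R := \sum_(j < m) (x.1 0 j ^+ 2 + x.2 0 j ^+ 2).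

Lemma sqnorm_ge0 x : 0 <= sqnorm x.
Proof. by apply: sumr_ge0 => j _; rewrite addr_ge0 ?sqr_ge0. Qed.

Lemma sqnorm_crot a x : sqnorm (crot a x) = sqnorm x.
Proof.
apply: eq_bigr => j _; rewrite !mxE.
transitivity ((cos a ^+ 2 + sin a ^+ 2) * (x.1 0 j ^+ 2 + x.2 0 j ^+ 2)); first by ring.
by rewrite cos2Dsin2 mul1r.
Qed.

Definition normalize x : cvec R m := (Num.sqrt (sqnorm x))^-1 *: x.

Lemma normalize_crot a x : normalize (crot a x) = crot a (normalize x).
Proof. by rewrite /normalize sqnorm_crot linearZ. Qed.

Lemma sphere_normalize x : sqnorm x != 0 -> sphere (normalize x).
Proof.
move=> x0; rewrite /sphere /= (eq_bigr (fun j =>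
  (Num.sqrt (sqnorm x))^-1 ^+ 2 * (x.1 0 j ^+ 2 + x.2 0 j ^+ 2))); last first.
  by move=> j _; rewrite !mxE; ring.
by rewrite -mulr_sumr exprVn sqr_sqrtr ?sqnorm_ge0 // mulVf.
Qed.

Lemma continuous_coord1 j : continuous (fun x : cvec R m => x.1 0 j).
Proof.
move=> x; apply: (@continuous_comp (cvec R m) 'rV[R]_m R fst (fun M => M 0 j)).
  exact: cvg_fst.
exact: coord_continuous.
Qed.

Lemma continuous_coord2 j : continuous (fun x : cvec R m => x.2 0 j).
Proof.
move=> x; apply: (@continuous_comp (cvec R m) 'rV[R]_m R snd (fun M => M 0 j)).
  exact: cvg_snd.
exact: coord_continuous.
Qed.

Lemma continuous_sqnorm : continuous sqnorm.
Proof.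
apply: (@continuous_big R^o 'I_m +%R 0 xpredT _ (cvec R m)) => [|j _ x].
  exact: add_continuous.
by apply: cvgD; apply: cvgM; (exact: continuous_coord1 || exact: continuous_coord2).
Qed.

Lemma continuous_crot a : continuous (@crot R m a).
Proof.
move=> x.
have x1 : y.1 @[y --> x] --> x.1 by exact: cvg_fst.
have x2 : y.2 @[y --> x] --> x.2 by exact: cvg_snd.
have cst (r : R) : (fun=> r) y @[y --> x] --> r by exact: cvg_cst.
apply: (@cvg_pair _ _ _ (nbhs x) (nbhs (crot a x).1) (nbhs (crot a x).2) _ _ _
  (fun y => cos a *: y.1 - sin a *: y.2) (fun y => sin a *: y.1 + cos a *: y.2)).
  exact: (cvgB (cvgZ (cst _) x1) (cvgZ (cst _) x2)).
exact: (cvgD (cvgZ (cst _) x1) (cvgZ (cst _) x2)).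
Qed.

Lemma continuous_normalize x : sqnorm x != 0 -> {for x, continuous normalize}.
Proof.
move=> x0; apply: cvgZ; last exact: cvg_id.
apply: cvgV; first by rewrite sqrtr_eq0 -ltNge lt_neqAle eq_sym x0 sqnorm_ge0.
apply: (continuous_comp (g := Num.sqrt)); first exact: continuous_sqnorm.
exact: sqrt_continuous.
Qed.

End Rotation.

Section CyclicAction.
Variables (R : realType) (p : nat) (hp : prime p) (hodd : odd p).

Definition angle (k : nat) : R := 2 * pi * k%:R / p%:R.

Let p0 : p%:R != 0 :> R.
Proof. by rewrite pnatr_eq0 -lt0n prime_gt0. Qed.

Lemma angle_mod k : angle k = angle (k %% p) + (pi *+ 2) *+ (k %/ p).
Proof.
rewrite /angle {1}(divn_eq k p) natrD natrM -mulr_natl -[_ *+ (k %/ p)]mulr_natl.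
by field.
Qed.

Lemma cos_angle_mod k : cos (angle (k %% p)) = cos (angle k).
Proof. by rewrite (angle_mod k) (periodicn (@cosD2pi R)). Qed.

Lemma sin_angle_mod k : sin (angle (k %% p)) = sin (angle k).
Proof. by rewrite (angle_mod k) (periodicn (@sinD2pi R)). Qed.

Lemma angleD j k : angle (j + k) = angle j + angle k.
Proof. by rewrite /angle natrD; field. Qed.

(** If the cosine were -1, the sine would be 0 and cos (p th) = (-1)^p = -1 for odd [p]; but p th is
    a multiple of 2 pi. *)
Lemma cos_angleB_gt j k : 0 < 1 + cos (angle j - angle k).
Proof.
set th := _ - _; have thE : th = angle j - angle k by []; clearbody th.
rewrite -ltrBlDl sub0r lt_neqAle cos_geN1 andbT; apply/eqP => cE.
have sE : sin th = 0.
  by apply/eqP; rewrite -sqrf_eq0; apply/eqP; have := cos2Dsin2 th; rewrite -cE; lra.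
have nth n : cos (th *+ n) = (-1) ^+ n /\ sin (th *+ n) = 0.
  elim: n => [|n [IHc IHs]]; first by rewrite mulr0n cos0 sin0 expr0.
  by rewrite mulrSr cosD sinD IHc IHs sE -cE !mulr0 mul0r subr0 addr0 exprSr.
have [+ _] := nth p; rewrite -signr_odd hodd expr1.
have -> : th *+ p = (pi *+ 2) *+ j - (pi *+ 2) *+ k.
  rewrite thE /angle -[LHS]mulr_natl -[_ *+ j]mulr_natl -[_ *+ k]mulr_natl -mulr_natl.
  by field.
rewrite -cosN opprB.
have -> : (pi *+ 2) *+ k - (pi *+ 2) *+ j = - ((pi *+ 2) *+ j) + (pi *+ 2) *+ k :> R.
  by rewrite addrC.
rewrite (periodicn (@cosD2pi R)) cosN -[X in cos X]add0r (periodicn (@cosD2pi R)) cos0.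
lra.
Qed.

Lemma cos_angle_gap :
  exists2 c : R, 0 < c & forall a b : 'F_p, c <= 1 + cos (angle a - angle b).
Proof.
exists (\big[Order.min/1]_(ab : 'F_p * 'F_p) (1 + cos (angle ab.1 - angle ab.2))).
  by apply: lt_bigmin => // ab _; apply: cos_angleB_gt.
by move=> a b; apply: (bigmin_le 1 (a, b)).
Qed.

Variable m : nat.
Implicit Types (a b : 'F_p) (x y : cvec R m).

Definition rotp a x : cvec R m := crot (angle a) x.

Lemma rotp_nat k x : rotp k%:R x = zeta_pow p k x.
Proof.
rewrite /rotp /zeta_pow /crot -/(angle k).
by rewrite val_Fp_nat // cos_angle_mod sin_angle_mod.
Qed.

Lemma rotp_add a b x : rotp (a + b) x = rotp a (rotp b x).
Proof.
rewrite -{1}[a]natr_Zp -{1}[b]natr_Zp -natrD rotp_nat /rotp -crotD -angleD.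
by [].
Qed.

Lemma rotp0 x : rotp 0 x = x.
Proof.
rewrite /rotp /crot /angle mulr0 mul0r cos0 sin0 !scale1r !scale0r subr0 add0r.
by case: x.
Qed.

Lemma sphere_rotp a x : sphere x -> sphere (rotp a x).
Proof. by rewrite /sphere /= => <-; apply: sqnorm_crot. Qed.

End CyclicAction.

(** * Half-spaces and a compact region avoiding the origin *)

Lemma avg_closed_ge (R : realType) (X : normedModType R) (l : X -> R) (c : R) :
  {morph l : x y / x + y} -> (forall a x, l (a *: x) = a * l x) ->
  avg_closed (fun x => c <= l x).
Proof.
move=> lD lZ s s0 cs.
have n0 : 0 < (size s)%:R :> R by rewrite ltr0n lt0n size_eq0.
have l0 : l 0 = 0 by rewrite -(scale0r 0) lZ mul0r.
rewrite /bary lZ (big_morph l lD l0) mulrC ler_pdivlMr // big_seq.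
apply: le_trans (ler_sum _ cs).
by rewrite -big_seq big_const_seq count_predT iter_addr_0 mulr_natr.
Qed.

Lemma avg_closedI (R : realType) (X : normedModType R) (C D : X -> Prop) :
  avg_closed C -> avg_closed D -> avg_closed (fun x => C x /\ D x).
Proof.
by move=> aC aD s s0 CD; split; [apply: aC | apply: aD] => // x /CD[].
Qed.

Lemma avg_closed_forall (R : realType) (X : normedModType R) I (C : I -> X -> Prop) :
  (forall i, avg_closed (C i)) -> avg_closed (fun x => forall i, C i x).
Proof. by move=> aC s s0 Cs i; apply: aC => // x /Cs. Qed.

Section Region.
Variables (R : realType) (m : nat).
Implicit Types (x y w : cvec R m) (c : R).

Definition box : set (cvec R m) :=
  [set x : cvec R m | forall j, -1 <= x.1 0 j <= 1] `&`
  [set x : cvec R m | forall j, -1 <= x.2 0 j <= 1].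

Definition l1norm x : R := \sum_(j < m) (`|x.1 0 j| + `|x.2 0 j|).

(** The l1 bound keeps points away from 0 but is not preserved by averaging; it will be derived from
    a linear lower bound. *)
Definition region c : set (cvec R m) := box `&` [set x : cvec R m | c <= l1norm x].

Lemma compact_box : compact box.
Proof.
pose B := [set z : 'rV[R]_m | forall j, -1 <= z 0 j <= 1].
have cB : compact B.
  have := @rV_compact R m (fun=> `[-1, 1]%classic) (fun=> @segment_compact R (-1) 1).
  congr compact; apply/seteqP; split=> z zB j; have := zB j;
    by rewrite /= in_itv.
exact: (compact_setX cB cB).
Qed.

Lemma continuous_l1norm : continuous l1norm.
Proof.
apply: (@continuous_big R^o 'I_m +%R 0 xpredT _ (cvec R m)) => [|j _ x].
  exact: add_continuous.
apply: (cvgD (cvg_norm (@continuous_coord1 _ _ j x)) (cvg_norm (@continuous_coord2 _ _ j x))).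
Qed.

Lemma compact_region c : compact (region c).
Proof.
have cl : closed [set x : cvec R m | c <= l1norm x].
  exact: ((continuous_closedP l1norm).1 continuous_l1norm _ (@closed_ge R c)).
rewrite /region setIC; apply: (subclosed_compact _ compact_box) => [|x [] //].
apply: closedI => //; apply: compact_closed compact_box.
exact: norm_hausdorff.
Qed.

Lemma region_sqnorm c x : 0 < c -> region c x -> sqnorm x != 0.
Proof.
move=> c0 [_ /= cx]; apply: contraTneq c0 => q0.
have q0j j : x.1 0 j ^+ 2 + x.2 0 j ^+ 2 = 0.
  apply/eqP; move: q0 => /eqP; rewrite psumr_eq0 => [/allP/(_ j)|i _].
    by rewrite mem_index_enum => /(_ isT).
  by rewrite addr_ge0 ?sqr_ge0.
rewrite -leNgt (le_trans cx) // /l1norm big1 // => j _.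
have /eqP := q0j j; rewrite paddr_eq0 ?sqr_ge0 // !sqrf_eq0 => /andP[/eqP-> /eqP->].
by rewrite normr0 addr0.
Qed.

Lemma avg_closed_box : avg_closed box.
Proof.
have aux (l : cvec R m -> R) : {morph l : x y / x + y} ->
    (forall a x, l (a *: x) = a * l x) -> avg_closed (fun x => -1 <= l x <= 1).
  move=> lD lZ s s0 ls; apply/andP; split.
    by apply: (avg_closed_ge lD lZ) => // x /ls /andP[].
  rewrite -lerN2; apply: (@avg_closed_ge _ _ (fun x => - l x)) => //.
  - by move=> x y; rewrite lD opprD.
  - by move=> a x; rewrite lZ mulrN.
  - by move=> x /ls /andP[]; rewrite lerN2.
apply: avg_closedI; apply: avg_closed_forall => j.
  by apply: (aux (fun x => x.1 0 j)) => [x y|a x]; rewrite mxE.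
by apply: (aux (fun x => x.2 0 j)) => [x y|a x]; rewrite mxE.
Qed.

Definition dot w x : R := \sum_(j < m) (w.1 0 j * x.1 0 j + w.2 0 j * x.2 0 j).

Lemma avg_closed_dot w c : avg_closed (fun x => c <= dot w x).
Proof.
apply: avg_closed_ge => [x y|a x]; rewrite /dot.
  by rewrite -big_split; apply: eq_bigr => j _; rewrite /= !mxE; ring.
by rewrite mulr_sumr; apply: eq_bigr => j _; rewrite /= !mxE; ring.
Qed.

Lemma dot_l1norm w x : (forall j, `|w.1 0 j| <= 2) -> (forall j, `|w.2 0 j| <= 2) ->
  dot w x <= 2 * l1norm x.
Proof.
move=> w1 w2; rewrite mulr_sumr; apply: ler_sum => j _; rewrite mulrDr.
by apply: lerD; apply: le_trans (ler_norm _) _; rewrite normrM ler_wpM2r.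
Qed.

(** Levels 2q and 2q + 1 share the q-th axis. From level 2m on the vector is 0, whence the later
    bounds by [m.*2]. *)
Definition basepoint (j : nat) : cvec R m := (\row_(i < m) (i == j./2 :> nat)%:R, 0).

End Region.

Section TowerRegion.
Variables (R : realType) (m p : nat) (c : R).
Hypothesis gap : forall a b : 'F_p, c <= 1 + cos (angle R p a - angle R p b).

Local Notation simplex := (tower_simplex (@rotp R p m) (@basepoint R m)).

Lemma box_basepoint (a : 'F_p) j : box (rotp a (basepoint R m j)).
Proof.
have aux (r : R) (b : bool) : `|r| <= 1 -> -1 <= r * b%:R <= 1.
  by rewrite -ler_norml; case: b; rewrite ?mulr1 // mulr0 normr0.
have c1 : `|cos (angle R p a)| <= 1 by rewrite ler_norml cos_geN1 cos_le1.
have s1 : `|sin (angle R p a)| <= 1 by rewrite ler_norml sin_geN1 sin_le1.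
by split=> i /=; rewrite !mxE mulr0 ?subr0 ?addr0 aux.
Qed.

(** A linear functional that is at least [c] on the vertices is so on the hull; its coefficients are
    at most 2 in absolute value, whence c / 2. *)
Lemma simplex_region n s u x : (n < m.*2)%N ->
  simplex n s -> in_hull s u -> x \in u -> region (c / 2) x.
Proof.
move=> nm [_ [a sa]] su xu.
pose th j := angle R p (a j).
(* On each axis [w] is the sum of the two roots of unity chosen there, so either of them pairs with
   it to 1 + cos of the difference of their angles. *)
pose w : cvec R m := (\row_(q < m) (cos (th q.*2) + cos (th q.*2.+1)),
                      \row_(q < m) (sin (th q.*2) + sin (th q.*2.+1))).
have bx : box x.
  by apply: (su _ (@avg_closed_box _ _)) xu => y /sa[j _ ->]; apply: box_basepoint.
have dx : c <= dot w x.
  apply: (su _ (avg_closed_dot (w := w) (c := c))) xu => y /sa[j jn ->].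
  have jm : (j./2 < m)%N by rewrite -ltn_double; apply: leq_ltn_trans nm; lia.
  rewrite /dot (bigD1 (Ordinal jm)) //= big1 => [|i ine]; last first.
    rewrite !mxE (_ : (i == j./2 :> nat) = false) ?mulr0 ?subr0 ?addr0 ?mulr0 ?addr0 //.
    by apply: contra_neqF ine => /eqP ij; apply: val_inj.
  rewrite addr0 !mxE /= eqxx !mulr0 !mulr1 subr0 addr0 -/(th j).
  have := gap (a j./2.*2) (a j./2.*2.+1); rewrite -!/(th _) cosB => /le_trans; apply.
  have jE : j = j./2.*2 \/ j = j./2.*2.+1.
    by rewrite -{1 3}(odd_double_half j); case: (odd j); [right | left].
  move: (cos2Dsin2 (th j)) jE; move: j./2.*2 => k.
  by move=> + [jE|jE]; rewrite {}jE; nra.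
split=> //=; rewrite ler_pdivrMr // mulrC; apply: le_trans dx _.
by apply: dot_l1norm => q; rewrite mxE; apply: le_trans (ler_normD _ _) _;
  apply: lerD; rewrite ler_norml ?cos_geN1 ?cos_le1 ?sin_geN1 ?sin_le1.
Qed.

Lemma simplex_small : exists d : R, forall n s, simplex n s -> small d s.
Proof.
have [M [_ /(_ (M + 1))]] := compact_bounded (@compact_box R m).
rewrite ltrDl ltr01 => /(_ isT) bM.
exists (M + 1 + (M + 1)) => n s [_ [a sa]] x y /sa[j _ ->] /sa[k _ ->].
by apply: le_trans (ler_normB _ _) _; apply: lerD; apply: bM; apply: box_basepoint.
Qed.

End TowerRegion.

(** * Equivariant labelling *)

Section LabelledSubdivision.
Variables (R : realType) (m p t : nat) (hp : prime p) (hodd : odd p).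
Variable lam : cvec R m -> 'I_t * 'F_p.
Variables (A : set (cvec R m)) (r : nat) (d : R).
Let N := m.*2.
Local Notation act := (@rotp R p m).
Local Notation v := (@basepoint R m).
Hypothesis simplexA : forall n s u x, (n < N)%N ->
  tower_simplex act v n s -> in_hull s u -> x \in u -> A x.
Hypothesis simplexd : forall n s, tower_simplex act v n s -> small d s.
Hypothesis lamA : forall a x, A x -> lam (act a x) = shift_label a (lam x).
Hypothesis lam_proper : forall u, (forall x, x \in u -> A x) ->
  small ((N.-1%:R / N%:R) ^+ r * d) u -> proper_labels (map lam u).

(** Evaluation on the image under [lam] of the [r]-fold subdivision of h_k. *)
Definition label_eval k (f : seq ('I_t * 'F_p) -> 'F_p) : 'F_p :=
  tower act v k (iter r (@sd 'F_p R (cvec R m)) (fun s => f (map lam s))).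

Lemma eq_tower_sd n f g : (n < N)%N ->
  (forall u, size u = n.+1 -> (forall x, x \in u -> A x) ->
    proper_labels (map lam u) -> f u = g u) ->
  tower act v n (iter r (@sd 'F_p R (cvec R m)) f) =
  tower act v n (iter r (@sd 'F_p R (cvec R m)) g).
Proof.
move=> nN fg; apply: eq_tower => [a b x|x|s ts]; [exact: rotp_add|exact: rotp0|].
have ss : size s = n.+1 by case: ts.
apply: (@eq_iter_sd _ _ _ N _ d) => [||u us du su]; first by rewrite ss.
  exact: simplexd ts.
have Au x : x \in u -> A x by apply: simplexA ts su.
by apply: fg; rewrite ?us //; apply: lam_proper.
Qed.

Lemma period_sd n f s : period act n (iter r (@sd 'F_p R (cvec R m)) f) s =
  iter r (@sd 'F_p R (cvec R m)) (period act n f) s.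
Proof.
rewrite /period; case: (odd n).
  by rewrite /odiff iter_sd_map iter_sdB.
by rewrite /osum iter_sd_sum; apply: eq_bigr => a _; rewrite iter_sd_map.
Qed.

(** Subdivision is a chain map commuting with the linear rotations, so [tower_cobd] survives it. As
    [lam] is equivariant only on [A], rotations become label shifts through [eq_tower_sd]. *)
Lemma label_eval_cobd k f : (k.+1 < N)%N ->
  label_eval k.+1 (cobd f) = label_eval k (period (@shift_label p t) k.+1 f).
Proof.
move=> kN; rewrite /label_eval.
have -> : (fun s => cobd f (map lam s)) = cobd (fun s => f (map lam s)).
  by apply: funext => s; rewrite cobd_map.
rewrite iter_sd_cobd tower_cobd //; last exact: rotp_add.
rewrite (_ : period act k.+1 _ = iter r (@sd 'F_p R (cvec R m))
  (period act k.+1 (fun s => f (map lam s)))); last first.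
  by apply: funext => s; rewrite period_sd.
apply: eq_tower_sd => [|u _ Au _]; first exact: ltnW.
have E a : map lam (map (act a) u) = map (shift_label a) (map lam u).
  by rewrite -!map_comp; apply/eq_in_map => x /Au Ax /=; rewrite lamA.
rewrite /period; case: (odd _); first by rewrite /odiff E.
by apply: eq_bigr => a _; rewrite E.
Qed.

Lemma labelled_subdivision_false : (t * (p - 1) < N)%N -> False.
Proof.
move=> tN.
apply: (@labelled_tower_false p t hp hodd N label_eval) => //.
- move=> k f g kN fg; apply: eq_tower_sd => // u us _ pu.
  by apply: fg; rewrite ?size_map.
- exact: label_eval_cobd.
- move=> k; rewrite /label_eval.
  have -> : iter r (@sd 'F_p R (cvec R m)) (fun=> 0) = fun=> 0.
    elim: r => //= n ->; apply: funext => s.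
    by have := sdB (fun=> 0 : 'F_p) (fun=> 0) s; rewrite !subrr.
  exact: tower0.
(* Subdividing a vertex yields a single vertex, where the augmentation is 1. *)
- rewrite /label_eval /=; move: (v 0) => x.
  have -> n : iter n (@sd 'F_p R (cvec R m)) (fun s => (size (map lam s) == 1%N)%:R) [:: x] = 1.
    elim: n x => //= n IHn x.
    by rewrite /sd /= /cone /= subr0 IHn.
  by [].
Qed.

End LabelledSubdivision.

(** * Equivariant labels read off the closed sets *)

Section ClosedSets.
Variables (R : realType) (m p t : nat) (hp : prime p) (hodd : odd p).
Variable U : 'I_t -> set (cvec R m).
Hypothesis closedU : forall i, closed (U i).
Hypothesis no_orbit : forall i x, sphere x -> exists a : 'F_p, ~ U i (rotp a x).
Hypothesis meets : forall x, sphere x -> exists i (a : 'F_p), U i (rotp a x).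

(** The minus sign makes rotation of [x] by [a] translate the set by [+a]. *)
Definition hits i x : {set 'F_p} :=
  [set k | `[< U i (rotp (- k) (normalize x)) >]]%SET.

Lemma hits_rotp i a x : hits i (rotp a x) = [set k | k - a \in hits i x]%SET.
Proof.
apply/setP => k; rewrite !inE /rotp normalize_crot -!/(rotp _ _) -rotp_add //.
by rewrite opprB addrC.
Qed.

(** The mean of a hit set may lie outside it, so an element is picked by its offset [j] from the
    mean, which rotation does not change. The default [l0] is never reached at nonzero [x]. *)
Definition label (l0 : 'I_t * 'F_p) x : 'I_t * 'F_p :=
  if [pick i | hits i x != finset.set0] is Some i then
    if [pick j | Fp_center (hits i x) + j \in hits i x] is Some j
    then (i, Fp_center (hits i x) + j) else l0
  else l0.

Lemma hits_card i x : sqnorm x != 0 -> (#|hits i x| < p)%N.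
Proof.
move=> x0; have [a Ua] := no_orbit i (sphere_normalize x0).
rewrite -[X in (_ < X)%N](card_Fp hp) -cardsT; apply: proper_card.
rewrite properT; apply/eqP => /setP/(_ (- a)); rewrite !inE opprK => /asboolP.
exact: Ua.
Qed.

Lemma label_rotp l0 a x : sqnorm x != 0 -> label l0 (rotp a x) = shift_label a (label l0 x).
Proof.
move=> x0; rewrite /label.
have E0 i : (hits i (rotp a x) != finset.set0) = (hits i x != finset.set0).
  rewrite hits_rotp; apply/set0Pn/set0Pn => [[k]|[k ks]].
    by rewrite inE => ks; exists (k - a).
  by exists (k + a); rewrite inE addrK.
rewrite (eq_pick E0); case: pickP => [i i0|noi].
  have cE : Fp_center (hits i (rotp a x)) = Fp_center (hits i x) + a.
    by rewrite hits_rotp Fp_center_shift // card_gt0 i0 hits_card.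
  have E j : (Fp_center (hits i (rotp a x)) + j \in hits i (rotp a x)) =
             (Fp_center (hits i x) + j \in hits i x).
    by rewrite cE hits_rotp inE addrAC addrK.
  rewrite (eq_pick E); case: pickP => [j _|noj].
    by rewrite cE /shift_label /= addrAC.
  have [k ki] := set0Pn _ i0.
  by have := noj (k - Fp_center (hits i x)); rewrite addrC subrK ki.
have [i [b Ub]] := meets (sphere_normalize x0).
have /negbFE/eqP/setP/(_ (- b)) := noi i.
by rewrite !inE opprK; move/asboolP: Ub => ->.
Qed.

Lemma labelP l0 x : sqnorm x != 0 ->
  U (label l0 x).1 (rotp (- (label l0 x).2) (normalize x)).
Proof.
move=> x0; rewrite /label; case: pickP => [i i0|noi].
  case: pickP => [j|noj]; first by rewrite inE => /asboolP.
  have [k ki] := set0Pn _ i0.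
  by have := noj (k - Fp_center (hits i x)); rewrite addrC subrK ki.
have [i [b Ub]] := meets (sphere_normalize x0).
have /negbFE/eqP/setP/(_ (- b)) := noi i.
by rewrite !inE opprK; move/asboolP: Ub => ->.
Qed.

(* Lebesgue-number argument. *)
Lemma uniform_miss (A : set (cvec R m)) : compact A ->
  (forall x, A x -> sqnorm x != 0) ->
  exists2 e : R, 0 < e & forall x, A x -> forall i, exists a : 'F_p,
    forall y, `|x - y| < e -> ~ U i (rotp a (normalize y)).
Proof.
move=> cA A0.
pose P (e : R) (x : cvec R m) := forall i, exists a : 'F_p,
  forall y, `|x - y| < e -> ~ U i (rotp a (normalize y)).
have : \forall e \near 0^'+, A `<=` P e.
  apply: ((compact_near_coveringP A).1 cA) => x Ax.
  have [k Uk] := choice (fun i => no_orbit i (sphere_normalize (A0 _ Ax))).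
  have : \forall y \near x, forall i, ~ U i (rotp (k i) (normalize y)).
    apply: (@filter_forall _ _ (fun i y => ~ U i (rotp (k i) (normalize y))) (nbhs x)) => i.
    have cont : {for x, continuous (fun y => rotp (k i) (normalize y))}.
      apply: (@continuous_comp _ _ _ (@normalize R m) (@rotp R p m (k i))).
        exact: continuous_normalize (A0 _ Ax).
      exact: continuous_crot.
    apply: (cont (~` U i)); apply: open_nbhs_nbhs; split; last exact: Uk.
    exact: closed_openC.
  move=> /nbhs_normP[e /= e0 He].
  (* Half of the radius pays for moving the center from [x] to [z], half for the distance from [z]
     to [y]. *)
  have e2 : 0 < e / 2 by rewrite divr_gt0.
  near=> z e' => i; exists (k i) => y zy; apply: He => /=.
  have xz : `|x - z| < e / 2 by near: z; apply: cvgr_dist_lt.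
  have e'e : e' < e / 2 by near: e'; apply: nbhs_right_lt.
  rewrite -(subrK z x) -addrA [ltRHS]splitr; apply: le_lt_trans (ler_normD _ _) _.
  exact: ltrD xz (lt_trans zy e'e).
move=> H; near (0 : R)^'+ => e; exists e => //.
by near: e.
Unshelve. all: by end_near. Qed.

Lemma closed_sets_false : (0 < m)%N -> (t * (p - 1) < m.*2)%N -> False.
Proof.
move=> m0 tm.
have [c c0 gap] := @cos_angle_gap R p hp hodd.
have [d simplexd] := @simplex_small R m p.
have A0 x : @region R m (c / 2) x -> sqnorm x != 0.
  by apply: region_sqnorm; rewrite divr_gt0.
have [e e0 miss] := uniform_miss (@compact_region R m (c / 2)) A0.
set N := m.*2; pose K : R := N.-1%:R / N%:R.
(* The contraction factor is below 1, so enough subdivisions bring the diameter under [e]. *)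
have [r Kr] : exists r, K ^+ r * d < e.
  have K1 : `|K| < 1.
    rewrite ger0_norm ?divr_ge0 ?ler0n // ltr_pdivrMr ?mul1r ?ltr_nat ?ltr0n; lia.
  have : K ^+ n * d @[n --> \oo] --> 0 * d by apply: cvgMl; apply: cvg_expr.
  rewrite mul0r => /cvgr_lt /(_ e e0) [n _ Hn].
  by exists n; apply: Hn => /=.
(* The default label requires an index; [meets] supplies one at the normalized first vertex. *)
have [i0 _] : exists i0 : 'I_t, True.
  have [|i _] := @meets (normalize (basepoint R m 0)); last by exists i.
  apply: sphere_normalize; apply: A0.
  pose b := basepoint R m 0.
  apply: (@simplex_region R m p c gap 0 [:: b] [:: b] b).
  - by rewrite double_gt0.
  - split=> //; exists (fun=> 0) => x; rewrite inE => /eqP ->.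
    by exists 0%N; rewrite ?rotp0.
  - exact: in_hull_refl.
  - exact: mem_head.
apply: (@labelled_subdivision_false R m p t hp hodd (label (i0, 0))
  (@region R m (c / 2)) r d) => //.
- move=> n s u x; exact: simplex_region.
- by move=> a x /A0 x0; apply: label_rotp.
move=> u Au us i; case: u Au us => [|x u] Au us; first by exists 0.
(* All points of the sequence lie within [e] of its first entry, so one rotation [a] takes all their
   normalizations out of [U i], and the label (i, -a) does not occur. *)
have [a Ua] := miss x (Au x (mem_head _ _)) i.
exists (- a); apply/mapP => -[y yu yE].
have xy : `|x - y| < e by apply: le_lt_trans Kr; apply: us => //; rewrite mem_head.
apply: (Ua y xy); have := labelP (i0, 0) (A0 _ (Au y yu)).
by rewrite -yE /= opprK.
Qed.

End ClosedSets.

Theorem theorem2p1 (R : realType) (p m t : nat)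
  (hp : prime p) (hodd : odd p) (hm : (1 <= m)%N) (ht : (1 <= t)%N)
  (hdim : (t * (p - 1) < 2 * m)%N)
  (U : 'I_t.+1 -> set (cvec R m))
  (hclosed : forall i, closed (U i))
  (hcover : @sphere R m `<=` \bigcup_(i in [set: 'I_t.+1]) U i) :
  exists i : 'I_t.+1, exists x : cvec R m,
    @sphere R m x /\ forall k : nat, (k < p)%N -> U i (@zeta_pow R m p k x).
Proof.
apply: contrapT => noU.
have no_orbit i x : sphere x -> exists a : 'F_p, ~ U i (rotp a x).
  move=> Sx; apply: contrapT => full; apply: noU; exists i, x; split=> // k _.
  by rewrite -rotp_nat //; apply: contrapT => Uk; apply: full; exists k%:R.
(* Labels come from the sets other than the last: each orbit has a point outside the last set, and
   one of the others covers it. *)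
apply: (@closed_sets_false R m p t hp hodd (fun i => U (lift ord_max i))) => //.
- by move=> i x; apply: no_orbit.
- move=> x Sx; have [a Ua] := no_orbit ord_max x Sx.
  have [i _ Ui] := hcover _ (sphere_rotp a Sx).
  case: (unliftP ord_max i) Ui => [j ->|-> //] Uj.
  by exists j, a.
- by rewrite -mul2n.
Qed.
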